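(* Let $\mathcal S$ be a chain-vanishing collection of nonempty subsets of a set $X$, and let $A,B\in\mathcal S$ with $A\perp B$. Then there is $C\in[A]_{\mathcal S}$ with $C\supseteq B$.
   Context: Fix a nonempty set $X$; $A^c:=X\setminus A$. $A\perp B$ means $A\cap B=\emptyset$ and $A\ne B^c$. For $A,B\in\mathcal S$, $B$ is $\mathcal S$-maximally orthogonal to $A$ if $B\perp A$ and no $C\in\mathcal S$ satisfies $C\perp A$, $C\supsetneq B$; $[A]_{\mathcal S}:=\{A\}\cup\{B\in\mathcal S:B$ is $\mathcal S$-maximally orthogonal to $A\}$. A chain is a sequence $(A_n)_{n\in\mathbb N}$ that is strictly increasing or strictly decreasing under inclusion; a decreasing (resp. increasing) chain is $\mathcal S$-vanishing if no $B\in\mathcal S$ satisfies $B\subseteq A_n$ (resp. $B\cap A_n=\emptyset$) for all $n$; $\mathcal S$ is chain-vanishing if every chain of members of $\mathcal S$ is $\mathcal S$-vanishing. *)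

(* Defs.v *)
(* Set equality is Leibniz equality (extensional under
   the whitelisted functional/propositional extensionality axioms). *)
From Stdlib Require Import Classical.

Definition set (X : Type) := X -> Prop.

Definition compl {X : Type} (A : set X) : set X := fun x => ~ A x.
Definition subset {X : Type} (A B : set X) : Prop := forall x, A x -> B x.
Definition psubset {X : Type} (A B : set X) : Prop := subset A B /\ ~ subset B A.
Definition disjoint {X : Type} (A B : set X) : Prop := forall x, ~ (A x /\ B x).

Definition orth {X : Type} (A B : set X) : Prop := disjoint A B /\ A <> compl B.

Definition max_orth {X : Type} (S : set X -> Prop) (A B : set X) : Prop :=
  orth B A /\ ~ (exists C, S C /\ orth C A /\ psubset B C).

Definition in_class {X : Type} (S : set X -> Prop) (A C : set X) : Prop :=
  C = A \/ (S C /\ max_orth S A C).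

Definition strictly_increasing {X : Type} (f : nat -> set X) : Prop :=
  forall n, psubset (f n) (f (S n)).
Definition strictly_decreasing {X : Type} (f : nat -> set X) : Prop :=
  forall n, psubset (f (S n)) (f n).

Definition dec_vanishing {X : Type} (S : set X -> Prop) (f : nat -> set X) : Prop :=
  ~ (exists B, S B /\ forall n, subset B (f n)).
Definition inc_vanishing {X : Type} (S : set X -> Prop) (f : nat -> set X) : Prop :=
  ~ (exists B, S B /\ forall n, disjoint B (f n)).

Definition chain_vanishing {X : Type} (S : set X -> Prop) : Prop :=
  forall f : nat -> set X, (forall n, S (f n)) ->
    (strictly_decreasing f -> dec_vanishing S f) /\
    (strictly_increasing f -> inc_vanishing S f).

(* Main.v *)
Require Import Defs.
From Stdlib Require Import Classical ClassicalEpsilon FunctionalExtensionality PropExtensionality.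

(* If no member of [[A]_S] contains [B], then starting from [B] one can keep
   enlarging a set of [S] orthogonal to [A] forever.  The resulting strictly
   increasing chain stays disjoint from [A], so [A] itself witnesses that it is
   not [S]-vanishing. *)

Lemma compl_compl {X : Type} (A : set X) : compl (compl A) = A.
Proof.
  apply functional_extensionality; intro x.
  apply propositional_extensionality; unfold compl; split.
  - apply NNPP.
  - intros h h'; exact (h' h).
Qed.

Lemma disjoint_sym {X : Type} (A B : set X) : disjoint A B -> disjoint B A.
Proof. intros Hd x [h1 h2]; exact (Hd x (conj h2 h1)). Qed.

Lemma orth_sym {X : Type} (A B : set X) : orth A B -> orth B A.
Proof.
  intros [Hd Hn]; split.
  - exact (disjoint_sym A B Hd).
  - intros E; apply Hn; rewrite E; symmetry; apply compl_compl.
Qed.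

Lemma subset_trans {X : Type} (A B C : set X) :
  subset A B -> subset B C -> subset A C.
Proof. intros h1 h2 x hx; exact (h2 x (h1 x hx)). Qed.

Lemma chain_of_no_maximal {T : Type} (P : T -> Prop) (R : T -> T -> Prop) (x0 : T) :
  P x0 -> (forall x, P x -> exists y, P y /\ R x y) ->
  exists f : nat -> T, forall n, P (f n) /\ R (f n) (f (S n)).
Proof.
  intros P0 Hext.
  assert (next : forall x : {x | P x}, {y : {y | P y} | R (proj1_sig x) (proj1_sig y)}).
  { intros [x Px]; apply constructive_indefinite_description.
    destruct (Hext x Px) as [y [Py Rxy]]; now exists (exist P y Py). }
  set (g := fix g (n : nat) : {x | P x} :=
         match n with O => exist P x0 P0 | S m => proj1_sig (next (g m)) end).
  exists (fun n => proj1_sig (g n)); intro n; split.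
  - exact (proj2_sig (g n)).
  - exact (proj2_sig (next (g n))).
Qed.

Lemma chain_vanishing_no_disjoint_increasing {X : Type} (S : set X -> Prop) (A : set X)
  (f : nat -> set X) :
  chain_vanishing S -> S A -> (forall n, S (f n)) -> strictly_increasing f ->
  ~ (forall n, disjoint A (f n)).
Proof.
  intros Hcv HA Hf Hinc Hdisj.
  apply (proj2 (Hcv f Hf) Hinc); exists A; split; assumption.
Qed.

Lemma max_orth_or_extension {X : Type} (S : set X -> Prop) (A D : set X) :
  orth D A ->
  max_orth S A D \/ exists C, S C /\ orth C A /\ psubset D C.
Proof.
  intros Ho; destruct (classic (exists C, S C /\ orth C A /\ psubset D C)) as [h | h].
  - now right.
  - left; now split.
Qed.

Theorem mainTheorem11 (X : Type) (HX : inhabited X) (S : set X -> Prop)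
  (Hne : forall A, S A -> exists x, A x)
  (Hcv : chain_vanishing S)
  (A B : set X) (HA : S A) (HB : S B) (HAB : orth A B) :
  exists C, in_class S A C /\ subset B C.
Proof.
  apply NNPP; intro Hno.
  set (P := fun D : set X => S D /\ orth D A /\ subset B D).
  assert (Hext : forall D, P D -> exists E, P E /\ psubset D E).
  { intros D [HD [Ho HBD]].
    destruct (max_orth_or_extension S A D Ho) as [Hmax | [E [HE [HoE HDE]]]].
    - exfalso; apply Hno; exists D; split; [right; now split | exact HBD].
    - exists E; split; [| exact HDE].
      split; [exact HE | split; [exact HoE | exact (subset_trans _ _ _ HBD (proj1 HDE))]]. }
  assert (PB : P B) by (split; [exact HB | split; [exact (orth_sym _ _ HAB) | now intro]]).
  destruct (chain_of_no_maximal P psubset B PB Hext) as [f Hf].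
  apply (chain_vanishing_no_disjoint_increasing S A f Hcv HA).
  - intro n; exact (proj1 (proj1 (Hf n))).
  - intro n; exact (proj2 (Hf n)).
  - intro n; destruct (proj1 (Hf n)) as [_ [[Hd _] _]].
    exact (disjoint_sym _ _ Hd).
Qed.
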